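(* Let $(X,d,\mu)$ be a complete metric space equipped with a doubling Borel measure $\mu$, and let $w$ be a weight on $X$. Then $w\in A_1(X)$ if and only if $w\in A_\infty(X)$ and $\log w\in BLO(X)$. Furthermore, $$\exp\left(\|\log w\|_{BLO}\right)\le [w]_1\le [w]_\infty\exp\left(\|\log w\|_{BLO}\right).$$
   Context: Balls $B=B(x,r)$ are open, and $2B=B(x,2r)$. The measure $\mu$ is doubling: there is $C_d>1$ such that $0<\mu(2B)\le C_d\,\mu(B)<\infty$ for all balls $B\subset X$. $L^1_{\mathrm{loc}}(X)$ is the set of functions integrable on every compact subset of $X$. A weight is a nonnegative function $w\in L^1_{\mathrm{loc}}(X)$. A nonnegative $w\in L^1_{\mathrm{loc}}(X)$ belongs to $A_1(X)$ if there is a constant $C<\infty$ with $\frac{1}{\mu(B)}\int_B w\,d\mu\le C\operatorname{ess\,inf}_B w$ for every ball $B\subset X$; the $A_1$ constant $[w]_1$ of $w$ is the smallest such constant. A nonnegative $w\in L^1_{\mathrm{loc}}(X)$ belongs to $A_\infty(X)$ if $[w]_\infty=\sup_B\left(\frac{1}{\mu(B)}\int_B w\,d\mu\right)\exp\left(-\frac{1}{\mu(B)}\int_B\log w\,d\mu\right)<\infty$, supremum over all balls $B\subset X$. A function $f\in L^1_{\mathrm{loc}}(X)$ belongs to $BLO(X)$ if $\|f\|_{BLO}=\sup_B\left(\frac{1}{\mu(B)}\int_B f\,d\mu-\operatorname{ess\,inf}_B f\right)<\infty$, supremum over all balls $B\subset X$.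
   Formalization: The weight w is assumed not to vanish almost everywhere: w = 0 satisfies the A_1 condition, but log w = -∞ is not locally integrable, so the stated equivalence fails for it. *)

(* Defs.v *)
From HB Require Import structures.
From mathcomp Require Import all_boot all_order all_algebra.
From mathcomp Require Import all_classical all_reals all_analysis.

Set Implicit Arguments.
Unset Strict Implicit.
Unset Printing Implicit Defensive.

Import Order.TTheory GRing.Theory Num.Theory.
Import numFieldNormedType.Exports.

Local Open Scope classical_set_scope.
Local Open Scope ring_scope.
Local Open Scope ereal_scope.

(* Balls of a [metricType] are [ball x r = [set y | mdist x y < r]], whereas
   those of a mere [pseudoMetricType] need not be open.  Complete types are
   pointed in the library, which only excludes the empty space. *)
#[short(type="completeMetricType")]
HB.structure Definition CompleteMetric (R : realType) :=
  { T of CompletePseudoMetric R T & PseudoMetric_isMetric R T }.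

Notation borel X := (g_sigma_algebraType (@open X)).

Section defs.
Context {R : realType} {X : completeMetricType R}.
Variable mu : {measure set (borel X) -> \bar R}.
Implicit Types (B : set X) (f w : X -> \bar R).

Definition doubling : Prop := exists Cd : R, (1 < Cd)%R /\
  forall (x : X) (r : R), (0 < r)%R ->
    [/\ 0 < mu (ball x (2 * r)%R),
        mu (ball x (2 * r)%R) <= Cd%:E * mu (ball x r) &
        Cd%:E * mu (ball x r) < +oo].

Definition balls : set (set X) :=
  [set B | exists (x : X) (r : R), (0 < r)%R /\ B = ball x r].

Definition L1loc f : Prop :=
  forall K : set X, compact K -> mu.-integrable K f.

Definition avg B f : \bar R := (mu B)^-1 * \int[mu]_(x in B) f x.

(* [ess_inf] relativized to [B] *)
Definition ess_inf_on B f : \bar R :=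
  ereal_sup [set y | \forall x \ae mu, B x -> y <= f x].

Definition weight w : Prop := (forall x, 0 <= w x) /\ L1loc w.

Definition A1_bound w (C : R) : Prop :=
  forall B, balls B -> avg B w <= C%:E * ess_inf_on B w.

Definition A1 w : Prop := weight w /\ exists C : R, A1_bound w C.

(* +oo when w is not in A1; otherwise the infimum is attained, unless w = 0
   almost everywhere *)
Definition A1_const w : \bar R := ereal_inf [set C%:E | C in A1_bound w].

Definition Ainfty_const w : \bar R :=
  ereal_sup [set avg B w * expeR (- avg B (fun x => lne (w x))) | B in balls].

Definition Ainfty w : Prop := weight w /\ Ainfty_const w < +oo.

(* The norm is +oo outside L1loc: there, [avg B f] and [ess_inf_on B f] may
   both be -oo, and \bar R sets -oo - -oo = -oo. *)
Definition BLO_norm f : \bar R :=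
  if `[< L1loc f >] then
    ereal_sup [set avg B f - ess_inf_on B f | B in balls]
  else +oo.

Definition BLO f : Prop := L1loc f /\ BLO_norm f < +oo.

End defs.

(* Main.v *)
(* Doubling bounds the number of e-separated points of a ball, so balls are
   totally bounded and, X being complete, have compact closure: locally
   integrable functions are integrable on balls.

   If w is an A_1 weight that is not almost everywhere 0, the A_1 inequality on
   large balls forces ess inf_B w > 0 on every ball B, so that log w is locally
   integrable.  Since exp (ess inf_B log w) = ess inf_B w, and, by Jensen's
   inequality, exp (avg_B log w) <= avg_B w, the numbers a = avg_B w,
   l = avg_B log w and L = ess inf_B log w satisfy L <= l, e^l <= a and
   a <= C e^L.  Hence e^(l - L) <= C and a e^(-l) <= C.  Conversely, l - L <= N
   and a e^(-l) <= A give a <= A e^N e^L. *)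

Require Import Defs.
From mathcomp Require Import all_boot all_order all_algebra.
From mathcomp Require Import all_classical all_reals all_analysis.
From mathcomp Require Import measurable_realfun lra.

Import Order.TTheory GRing.Theory Num.Theory.
Import numFieldNormedType.Exports.

Local Open Scope classical_set_scope.
Local Open Scope ring_scope.
Local Open Scope ereal_scope.

(** * Metric balls, and compactness of closures of totally bounded sets *)

Section metric_balls.
Context {R : realType} {X : completeMetricType R}.
Implicit Types (x y : X) (r e : R).

Lemma open_ball x r : open (ball x r).
Proof.
rewrite openE => y; rewrite ballEmdist /= => xy.
apply/nbhs_ballP; exists (r - mdist x y)%R => /=; first by rewrite subr_gt0.
move=> z; rewrite !ballEmdist /= => yz.
by have := metric_triangle x y z; lra.
Qed.

Lemma subset_ball x y r e : (mdist y x + r <= e)%R -> ball x r `<=` ball y e.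
Proof.
move=> le_e z; rewrite !ballEmdist /= => xz.
by have := metric_triangle y x z; lra.
Qed.

(** Each [y] has the neighbourhood [ball y 1] inside [ball x n] as soon as [n >= mdist x y + 1];
    compactness makes one [n] serve all of [K]. *)
Lemma compact_sub_ball (K : set X) x : compact K ->
  exists2 r, (0 < r)%R & K `<=` ball x r.
Proof.
move=> /compact_near_coveringP Kcov.
have : \forall n \near \oo, K `<=` (fun z => ball x n%:R z).
  apply: Kcov => y _.
  exists (ball y 1%R, [set n | (mdist x y + 1 <= n%:R)%R]).
    split => /=; first exact: nbhsx_ballx.
    near=> n; near: n; exact: nbhs_infty_ger.
  by move=> [z n] /= [yz xn]; exact: subset_ball yz.
(* [N.+1] instead of [N] keeps the radius positive. *)
move=> [N _ /(_ N.+1)] /= sub; exists N.+1%:R => //.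
exact: (sub (leqnSn N)).
Unshelve. all: by end_near. Qed.

Lemma ultra_bigcup_seq (T : Type) (I : choiceType) (F : set_system T)
    (s : seq I) (f : I -> set T) : UltraFilter F -> F (\bigcup_(i in [set` s]) f i) ->
  exists i, F (f i).
Proof.
move=> UF; rewrite bigcup_seq; elim: s => [|i s IHs].
  by rewrite big_nil => /filter_ex[].
rewrite big_cons => Fs.
have [Fi|FNi] := in_ultra_setVsetC (f i) UF; first by exists i.
by apply: IHs; apply: filterS2 Fs FNi => x [].
Qed.

(** If balls of radius [e / 2] cover [A], those of radius [e] cover its closure. An ultrafilter
    containing the closure thus contains a ball of each radius, so it is Cauchy and converges by
    completeness. *)
Lemma compact_closure (A : set X) :
  (forall e, (0 < e)%R ->
    exists s : seq X, A `<=` \bigcup_(y in [set` s]) ball y e) ->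
  compact (closure A).
Proof.
move=> tbA; rewrite compact_ultra => F UF FA.
suff /cauchy_cvgP cvgF : cauchy F.
  (* The interior of [B] meets the closure of [A] in some [z]; as [B] is a neighbourhood of [z], it
     meets [A]. *)
  exists (lim F); split => //= B nB.
  have [z [+ zB]] := filter_ex (filterI FA (cvgF _ (nbhs_interior nB))).
  exact.
apply: cauchy_exP => e e0.
have [s As] := tbA (e / 2)%R ltac:(lra).
apply: (@ultra_bigcup_seq _ _ F s (fun y => ball y e)).
apply: filterS FA => x /(_ (ball x (e / 2)%R)) [].
  by apply: nbhsx_ballx; lra.
move=> y [/As[z zs zy] xy]; exists z => //.
by apply: ball_split zy _; exact: ball_sym.
Qed.

End metric_balls.

(** * Doubling measures: size of balls and their total boundedness *)

Section doubling_balls.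
Context {R : realType} {X : completeMetricType R}.
Variable mu : {measure set (borel X) -> \bar R}.
Hypothesis mu_doubling : doubling mu.
Implicit Types (x y : X) (r e : R).

Lemma measurable_open (A : set X) : open A -> measurable (A : set (borel X)).
Proof. exact: sub_sigma_algebra. Qed.

Lemma measurable_closed (A : set X) : closed A ->
  measurable (A : set (borel X)).
Proof.
move=> cA; rewrite -(setCK A).
by apply: measurableC; apply: measurable_open; exact: closed_openC.
Qed.

Lemma measurable_metric_ball x r : measurable (ball x r : set (borel X)).
Proof. by apply: measurable_open; exact: open_ball. Qed.

Lemma ball_measure_gt0 x r : (0 < r)%R -> 0 < mu (ball x r).
Proof.
have [Cd [_ dbl]] := mu_doubling; move=> r0.
have [+ _ _] := dbl x (r / 2)%R ltac:(lra).
by rewrite mulrC divfK.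
Qed.

Lemma ball_measure_lty x r : (0 < r)%R -> mu (ball x r) < +oo.
Proof.
have [Cd [Cd1 dbl]] := mu_doubling; move=> r0.
have [_ _] := dbl x r r0; apply: le_lt_trans.
by rewrite lee_pemull // lee_fin ltW.
Qed.

Lemma ball_measure_fin_num x r : (0 < r)%R -> mu (ball x r) \is a fin_num.
Proof. by move=> r0; rewrite ge0_fin_numE // ball_measure_lty. Qed.

Lemma doubling_iter : exists2 Cd : R, (0 < Cd)%R & forall n x r, (0 < r)%R ->
  mu (ball x (2 ^+ n * r)%R) <= (Cd ^+ n)%:E * mu (ball x r).
Proof.
have [Cd [Cd1 dbl]] := mu_doubling; exists Cd; first lra.
move=> + x r r0; elim=> [|n IHn]; first by rewrite !expr0 mul1r mul1e.
rewrite exprS -mulrA exprS EFinM -muleA.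
have [|_ le2 _] := dbl x (2 ^+ n * r)%R; first by rewrite mulr_gt0 // exprn_gt0.
by apply: le_trans le2 _; rewrite lee_pmul2l // lte_fin; lra.
Qed.

(** Balls of radius [e / 2] about [e]-separated centres are disjoint, so their measures add up. *)
Lemma separated_measure_ge (s : seq X) e (c : R) : (0 < e)%R ->
  (forall y, y \in s -> c%:E <= mu (ball y (e / 2)%R)) ->
  pairwise (fun y z => e <= mdist y z)%R s ->
  ((size s)%:R * c)%:E <= mu (\bigcup_(y in [set` s]) ball y (e / 2)%R).
Proof.
move=> e0; rewrite bigcup_seq; elim: s => [|y s IHs] cs.
  by rewrite mul0r measure_ge0.
rewrite pairwise_cons => /andP[/allP ys seps].
rewrite big_cons measureU; first last.
- rewrite -bigcup_seq -subset0 => z [yz [t /= /ys yt tz]].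
  move: yz tz; rewrite !ballEmdist /= => yz tz.
  by have := metric_triangle y z t; rewrite (metric_sym z t); lra.
- rewrite -bigcup_seq; apply: measurable_open; apply: bigcup_open => z _.
  exact: open_ball.
- exact: measurable_metric_ball.
rewrite /= -natr1 mulrDl mul1r addrC EFinD; apply: leeD.
  by apply: cs; rewrite mem_head.
by apply: IHs seps => z zs; apply: cs; rewrite in_cons zs orbT.
Qed.

(** An [e]-separated family in the ball of maximal size is an [e]-net, since an uncovered point
    could be added to it. Sizes are bounded: the disjoint balls of radius [e / 2] lie in a ball of
    measure [M], and each has measure at least [M / Cd ^+ n]. *)
Lemma ball_totally_bounded x r e : (0 < r)%R -> (0 < e)%R ->
  exists s : seq X, ball x r `<=` \bigcup_(y in [set` s]) ball y e.
Proof.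
move=> r0 e0; have [Cd Cd0 dbl] := doubling_iter.
pose n := (Num.truncn ((2 * r + e) / (e / 2))%R).+1.
have e20 : (0 < e / 2)%R by lra.
have re0 : (0 < r + e)%R by lra.
(* With this [n], doubling [ball y (e / 2)] [n] times covers [ball x (r + e)] for every [y] in
   [ball x r]. *)
have big_n : (2 * r + e <= 2 ^+ n * (e / 2))%R.
  rewrite -ler_pdivrMr //; apply: ltW.
  apply: lt_le_trans (truncnS_gt _) _; rewrite -natrX ler_nat.
  exact: ltnW (ltn_expl _ _).
pose M := fine (mu (ball x (r + e)%R)).
have ME : mu (ball x (r + e)%R) = M%:E.
  by rewrite fineK // ball_measure_fin_num.
have M0 : (0 < M)%R by rewrite -lte_fin -ME ball_measure_gt0.
have Cdn0 : (0 < Cd ^+ n)%R by rewrite exprn_gt0.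
pose P k := `[< exists s : seq X, [/\ size s = k, {in s, forall y, ball x r y} &
  pairwise (fun y z => e <= mdist y z)%R s] >].
have exP : exists k, P k by exists 0%N; apply/asboolP; exists nil.
have leP k : P k -> (k <= Num.truncn (Cd ^+ n))%N.
  move=> /asboolP[s [<- sr seps]].
  have cs y : y \in s -> (M / Cd ^+ n)%:E <= mu (ball y (e / 2)%R).
    move=> /sr; rewrite ballEmdist /= => xy.
    rewrite mulrC EFinM lee_pdivrMl // -ME.
    apply: le_trans (dbl n y (e / 2)%R e20); apply: le_measure; rewrite ?inE;
      [exact: measurable_metric_ball..|].
    by apply: subset_ball; rewrite metric_sym; lra.
  have le_M : mu (\bigcup_(y in [set` s]) ball y (e / 2)%R) <= M%:E.
    rewrite -ME; apply: le_measure; rewrite ?inE; last 1 first.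
    - move=> z [y /= /sr xy]; apply: subset_ball.
      by move: xy; rewrite ballEmdist /=; lra.
    - by apply: measurable_open; apply: bigcup_open => z _; exact: open_ball.
    - exact: measurable_metric_ball.
  have := le_trans (separated_measure_ge _ _ _ e0 cs seps) le_M.
  rewrite lee_fin mulrA ler_pdivrMr // mulrC ler_pM2l // => le_s.
  by rewrite truncn_ge_nat // ltW.
case: (ex_maxnP exP leP) => k /asboolP[s [sk sr seps]] kmax.
exists s => z xz; apply: contrapT => nz.
suff /kmax : P k.+1 by rewrite ltnn.
apply/asboolP; exists (z :: s); split => /=; first by rewrite sk.
  by move=> y; rewrite in_cons => /predU1P[->//|/sr].
rewrite seps andbT; apply/allP => y ys; rewrite leNgt; apply/negP => yz.
by apply: nz; exists y => //; apply: ball_sym; rewrite ballEmdist.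
Qed.

Lemma L1loc_integrable_ball f x r : (0 < r)%R -> L1loc mu f ->
  mu.-integrable (ball x r) f.
Proof.
move=> r0 /(_ (closure (ball x r))) fint.
apply: integrableS (fint _).
- by apply: measurable_closed; exact: closed_closure.
- exact: measurable_metric_ball.
- exact: subset_closure.
by apply: compact_closure => e e0; exact: ball_totally_bounded.
Qed.

End doubling_balls.

Lemma aeS {d} {T : measurableType d} {R : realType}
    (mu : {measure set T -> \bar R}) (P Q : T -> Prop) :
  (forall x, P x -> Q x) -> (\forall x \ae mu, P x) -> \forall x \ae mu, Q x.
Proof.
by move=> PQ; apply: (@filterS _ _ (ae_filter_ringOfSetsType mu) _ _ PQ).
Qed.

(** * The extended logarithm: order, measurability and bounds *)

Section logarithm.
Context {R : realType}.
Local Notation lne := (@lne R).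

(** Negative [y] are no exception, because [lne] sends them to -oo. *)
Lemma lee_lne_fin (a : R) (y : \bar R) : (a%:E <= lne y) = ((expR a)%:E <= y).
Proof.
have [y0|y0] := ltP y 0.
  have ay : y < (expR a)%:E by rewrite (lt_trans y0) // lte_fin expR_gt0.
  by rewrite (le0_lneNy (ltW y0)) leNgt ltNyr leNgt ay.
by rewrite -lee_expeR (eqP (_ : expeR (lne y) == y)) ?lneK_eq.
Qed.

Lemma measurable_lne_comp {d} {T : measurableType d} (D : set T)
    (f : T -> \bar R) :
  measurable D -> measurable_fun D f -> measurable_fun D (lne \o f).
Proof.
move=> mD mf.
apply: (measurability _ (ErealGenCInfty.measurableE R)).
move=> _ [_ [a ->] <-].
rewrite (_ : _ `&` _ = D `&` [set x | (expR a)%:E <= f x]).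
  exact: emeasurable_fun_c_infty.
by apply/seteqP; split => x /= [Dx]; rewrite in_itv /= andbT lee_lne_fin.
Qed.

Lemma lne_le_id (y : \bar R) : 0 <= y -> lne y <= y.
Proof.
move=> y0; rewrite -lee_expeR (eqP (_ : expeR (lne y) == y)) ?lneK_eq //.
by apply: le_trans (expeR_ge1Dx _); rewrite leeDr.
Qed.

(** The logarithm lies between [ln a] and [y]. This dominates log w by an integrable function
    wherever [w] is at least [a]. *)
Lemma abse_lne_le (a : R) (y : \bar R) : (0 < a)%R -> a%:E <= y ->
  `|lne y| <= y + `|ln a|%:E.
Proof.
move=> a0 ay; have ly : (ln a)%:E <= lne y by rewrite lee_lne_fin lnK.
have y0 : 0 <= y by apply: le_trans ay; rewrite lee_fin ltW.
have := lne_le_id y y0.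
case: (lne y) ly => [z| |] //; last by rewrite leye_eq => _ /eqP ->.
case: y {ay} y0 => [t| |] //; last by move=> _ _ _; rewrite addye // leey.
rewrite -EFinD !lee_fin ler_norml => t0 az zt.
have := ler_norm (- ln a)%R; rewrite normrN => la.
have la0 := normr_ge0 (ln a).
by apply/andP; split; lra.
Qed.

(* The tangent line of the exponential at [l], evaluated at [lne y]. *)
Lemma tangent_lne_le (l : R) (y : \bar R) : 0 <= y ->
  (expR l)%:E * (lne y + (1 - l)%:E) <= y.
Proof.
move=> y0.
have -> : lne y + (1 - l)%:E = 1 + (lne y - l%:E).
  by case: (lne y) => [z| |] //=; rewrite -!EFinD; congr EFin; lra.
apply: (@le_trans _ _ ((expR l)%:E * expeR (lne y - l%:E))).
  by rewrite lee_pmul2l ?lte_fin ?expR_gt0 // expeR_ge1Dx.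
rewrite -[(expR l)%:E]/(expeR l%:E) -expeRD.
rewrite addeC subeK // (eqP (_ : expeR (lne y) == y)) //.
by rewrite lneK_eq.
Qed.

End logarithm.

(** * Averages over a set of positive finite measure, and Jensen's inequality *)

Section averages.
Context {R : realType} {X : completeMetricType R}.
Variable mu : {measure set (borel X) -> \bar R}.
Variable B : set X.
Hypotheses (mB : measurable (B : set (borel X))) (B_gt0 : 0 < mu B)
  (B_lty : mu B < +oo).
Implicit Types f g w : X -> \bar R.

Let b := fine (mu B).
Let muBE : mu B = b%:E. Proof. by rewrite fineK // ge0_fin_numE. Qed.
Let b_gt0 : (0 < b)%R. Proof. by rewrite -lte_fin -muBE. Qed.
Let avgE f : avg mu B f = b^-1%:E * \int[mu]_(x in B) f x.
Proof. by rewrite /avg muBE inver gt_eqF. Qed.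

Lemma avg_fin_num f : mu.-integrable B f -> avg mu B f \is a fin_num.
Proof. by move=> fi; rewrite avgE fin_numM // integrable_fin_num. Qed.

Lemma avg_cst (r : R) : avg mu B (cst r%:E) = r%:E.
Proof.
rewrite avgE integral_cst // muBE -!EFinM mulrCA mulVf ?mulr1 //.
by rewrite gt_eqF.
Qed.

Lemma le_avg f g : mu.-integrable B f -> mu.-integrable B g ->
  (\forall x \ae mu, B x -> f x <= g x) -> avg mu B f <= avg mu B g.
Proof.
move=> fi gi [N [mN N0 Nfg]]; rewrite !avgE lee_pmul2l ?lte_fin ?invr_gt0 //.
rewrite (negligible_integral mN) // [leRHS](negligible_integral mN) //.
have mBN : measurable (B `\` N : set (borel X)) by exact: measurableD.
have iBN h : mu.-integrable B h -> mu.-integrable (B `\` N) h.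
  exact: integrableS mB mBN (@subDsetl _ _ _).
apply: le_integral; [exact: mBN|exact: iBN|exact: iBN|].
move=> x; rewrite inE => -[Bx Nx]; apply: contrapT => fgx; apply: Nx.
by apply: Nfg => /= /(_ Bx).
Qed.

Lemma integrable_cstB (r : R) : mu.-integrable B (cst r%:E).
Proof.
apply/integrableP; split; first exact: measurable_cst.
by rewrite integral_cst // muBE -EFinM ltry.
Qed.

(** The positive part of [f] is dominated by [w], and the negative part only lowers the integral,
    possibly to -oo. *)
Lemma avg_lty w f : mu.-integrable B w ->
  measurable_fun (B : set (borel X)) f ->
  (forall x, 0 <= w x) -> (forall x, f x <= w x) -> avg mu B f < +oo.
Proof.
move=> wi mf w0 fw; rewrite avgE integralE.
rewrite lte_mul_pinfty ?lee_fin ?invr_ge0 ?ltW //.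
apply: (@le_lt_trans _ _ (\int[mu]_(x in B) w x)); last exact: integrable_lty.
apply: (@le_trans _ _ (\int[mu]_(x in B) f^\+ x)).
  by rewrite geeDl // oppe_le0 integral_ge0.
apply: ge0_le_integral => //.
- exact: measurable_funepos.
- exact: measurable_int wi.
- by move=> x _; rewrite funeposE ge_max fw w0.
Qed.

Lemma ess_inf_on_le_avg f : mu.-integrable B f ->
  ess_inf_on mu B f <= avg mu B f.
Proof.
move=> fi.
have le_r (r : R) : (\forall x \ae mu, B x -> r%:E <= f x) ->
    r%:E <= avg mu B f.
  move=> rf; rewrite -(avg_cst r).
  by apply: le_avg => //; exact: integrable_cstB.
apply: ge_ereal_sup => -[r /le_r //| /= yf|_]; last exact: leNye.
have afin := avg_fin_num f fi.
(* If +oo is a lower bound almost everywhere, so is the average plus one. *)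
have : (fine (avg mu B f) + 1)%:E <= (fine (avg mu B f))%:E.
  rewrite (fineK afin); apply: le_r.
  by apply: aeS yf => x + Bx => /(_ Bx); apply: le_trans; rewrite leey.
by rewrite lee_fin gerDl ler10.
Qed.

(** Jensen's inequality: average the tangent line at [l], the mean of log w. The mean of the tangent
    is [expR l * (l + (1 - l))]. *)
Lemma expeR_avg_lne w : (forall x, 0 <= w x) -> mu.-integrable B w ->
  mu.-integrable B (fun x => lne (w x)) ->
  expeR (avg mu B (fun x => lne (w x))) <= avg mu B w.
Proof.
move=> w0 wi lwi; have := avg_fin_num _ lwi.
set l := avg _ _ _ => lfin; rewrite -(fineK lfin) /=.
pose c := (1 - fine l)%R.
have int_c : mu.-integrable B (fun x => lne (w x) + c%:E).
  exact: integrableD lwi (integrable_cstB c).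
apply: (@le_trans _ _
  (avg mu B (fun x => (expR (fine l))%:E * (lne (w x) + c%:E)))).
  rewrite avgE integralZl // integralD //; last exact: integrable_cstB.
  rewrite muleCA muleDr //; last first.
    by rewrite fin_num_adde_defr // integrable_fin_num.
  rewrite -!avgE -/l -[X in _ + X]/(avg mu B (cst c%:E)).
  rewrite avg_cst -[X in X + _](fineK lfin) -EFinD /c addrC subrK.
  by rewrite mule1.
apply: le_avg => //; first exact: integrableZl.
by apply: aeW => x _; exact: tangent_lne_le.
Qed.

Lemma integrable_lne w (a : R) : (0 < a)%R -> mu.-integrable B w ->
  (forall x, 0 <= w x) -> (\forall x \ae mu, B x -> a%:E <= w x) ->
  mu.-integrable B (fun x => lne (w x)).
Proof.
move=> a0 wi w0 aw.
have mw : measurable_fun (B : set (borel X)) w by exact: measurable_int wi.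
have mlw := measurable_lne_comp _ _ mB mw.
have wai : mu.-integrable B (fun x => w x + `|ln a|%:E).
  exact: integrableD wi (integrable_cstB _).
apply/integrableP; split => //.
apply: le_lt_trans (integrable_lty mB wai); apply: ae_ge0_le_integral => //.
- exact: measurableT_comp.
- by move=> x _; rewrite adde_ge0.
- exact: measurable_int wai.
by apply: aeS aw => x + Bx => /(_ Bx); exact: abse_lne_le.
Qed.

End averages.

(** * Essential infima over a set *)

Section essential_infimum.
Context {R : realType} {X : completeMetricType R}.
Variable mu : {measure set (borel X) -> \bar R}.
Implicit Types (B : set X) (f w : X -> \bar R).

Lemma ess_inf_on_ge0 B w : (forall x, 0 <= w x) -> 0 <= ess_inf_on mu B w.
Proof. by move=> w0; apply: ereal_sup_ubound; apply: aeW => x _. Qed.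

Lemma subset_ess_inf_on B B' f : B `<=` B' ->
  ess_inf_on mu B' f <= ess_inf_on mu B f.
Proof.
move=> sub; apply: ge_ereal_sup => y yf; apply: ereal_sup_ubound.
by apply: aeS yf => x + /sub; exact.
Qed.

(** [expeR] and [lne] are inverse and increasing on nonnegative values, so they match the lower
    bounds of [w] with those of log w; negative lower bounds are handled apart. *)
Lemma expeR_ess_inf_on_lne B w : (forall x, 0 <= w x) ->
  expeR (ess_inf_on mu B (fun x => lne (w x))) = ess_inf_on mu B w.
Proof.
move=> w0; have ess0 := ess_inf_on_ge0 B w w0.
have lneK0 y : 0 <= y -> expeR (lne y) = y :> \bar R.
  by move=> y0; apply/eqP; rewrite lneK_eq.
apply/eqP; rewrite eq_le; apply/andP; split.
  rewrite -[leRHS]lneK0 // lee_expeR; apply: ge_ereal_sup => z /= zw.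
  rewrite -lee_expeR lneK0 //; apply: ereal_sup_ubound.
  by apply: aeS zw => x + Bx => /(_ Bx); rewrite -lee_expeR lneK0.
apply: ge_ereal_sup => y /= yw.
have [y0|y0] := leP y 0; first exact: le_trans y0 (expeR_ge0 _).
rewrite -(lneK0 y (ltW y0)) lee_expeR; apply: ereal_sup_ubound.
apply: aeS yw => x + Bx => /(_ Bx) yx.
by rewrite -lee_expeR !lneK0 // ltW.
Qed.

Lemma ess_inf_on_gt0 B w : 0 < ess_inf_on mu B w ->
  exists2 a : R, (0 < a)%R & \forall x \ae mu, B x -> a%:E <= w x.
Proof.
move=> /ereal_sup_gt[[a| |] //= aw a0]; first by exists a.
exists 1%R => //; apply: aeS aw => x + Bx => /(_ Bx).
by apply: le_trans; rewrite leey.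
Qed.

End essential_infimum.

(** * Weights that are not almost everywhere zero *)

Section weights.
Context {R : realType} {X : completeMetricType R}.
Variable mu : {measure set (borel X) -> \bar R}.
Hypothesis mu_doubling : doubling mu.

(** One ball suffices, as an essential infimum is at most the average. This excludes the value -oo,
    whose exponential is 0. *)
Lemma BLO_norm_ge0 (f : X -> \bar R) : 0 <= BLO_norm mu f.
Proof.
rewrite /BLO_norm; case: asboolP => // f_loc.
have B0 := ball_measure_gt0 mu mu_doubling point 1%R ltr01.
have Boo := ball_measure_lty mu mu_doubling point 1%R ltr01.
have mB := measurable_metric_ball (point : X) 1%R.
have fi := L1loc_integrable_ball mu mu_doubling _ point 1%R ltr01 f_loc.
apply: (@le_trans _ _ (avg mu (ball (point : X) 1%R) f -
    ess_inf_on mu (ball (point : X) 1%R) f)); last first.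
  apply: ereal_sup_ubound; exists (ball (point : X) 1%R) => //.
  by exists point, 1%R.
rewrite sube_ge0 ?(avg_fin_num mu _ mB B0 Boo _ fi) ?orbT //.
exact: ess_inf_on_le_avg.
Qed.

Variable w : X -> \bar R.
Hypotheses (w_weight : weight mu w) (w_neq0 : ~ (\forall x \ae mu, w x = 0)).
Let log_w := fun x => lne (w x).

Let w_ge0 x : 0 <= w x. Proof. by case: w_weight. Qed.
Let w_int x (r : R) : (0 < r)%R -> mu.-integrable (ball x r) w.
Proof. by case: w_weight => _ ? ?; exact: L1loc_integrable_ball. Qed.
Let mball x (r : R) : measurable (ball x r : set (borel X)).
Proof. exact: measurable_metric_ball. Qed.
Let ball_gt0 x (r : R) : (0 < r)%R -> 0 < mu (ball x r).
Proof. exact: ball_measure_gt0. Qed.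
Let ball_lty x (r : R) : (0 < r)%R -> mu (ball x r) < +oo.
Proof. exact: ball_measure_lty. Qed.

Let balls_ball (x : X) (r : R) : (0 < r)%R -> balls (ball x r).
Proof. by move=> r0; exists x, r. Qed.

Let avg_ge0 B : 0 <= avg mu B w.
Proof. by rewrite mule_ge0 ?inve_ge0 // integral_ge0. Qed.

(** Otherwise [w] vanishes almost everywhere on each of the countably many balls of integer radius
    about [point], which cover [X]. *)
Lemma exists_ball_integral_gt0 :
  exists x (r : R), (0 < r)%R /\ 0 < \int[mu]_(y in ball x r) w y.
Proof.
apply: contrapT => no_ball; apply: w_neq0.
have w0 n : \forall x \ae mu, ball (point : X) n.+1%:R x -> w x = 0.
  have mw : measurable_fun (ball (point : X) n.+1%:R : set (borel X)) w.
    exact: measurable_int (w_int _ _ _).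
  apply: (ae_eq_integral_abs mu (mball point n.+1%:R) mw).1.
  apply/eqP; rewrite eq_le integral_ge0 // andbT leNgt; apply/negP => int_gt0.
  apply: no_ball; exists point, n.+1%:R; split => //.
  by under eq_integral do rewrite -[w _]gee0_abs //.
apply: aeS (ae_foralln w0) => x w0x.
apply: (w0x (Num.truncn (mdist point x))); rewrite ballEmdist /=.
exact: truncnS_gt.
Qed.

Let avg_ball_gt0 x (r : R) : (0 < r)%R -> 0 < \int[mu]_(y in ball x r) w y ->
  0 < avg mu (ball x r) w.
Proof.
move=> r0 int_gt0; have B0 := ball_gt0 x r r0.
by rewrite /avg mule_gt0 // inve_gt0 ?(gt_eqF B0) // (lt_eqF (ball_lty x r r0)).
Qed.

(** * Consequences of an A_1 bound *)

Section A1.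
Variable C : R.
Hypothesis wC : A1_bound mu w C.

(* Enlarge the ball until it contains one on which [w] has positive integral. *)
Lemma A1_bound_ess_inf_gt0 x (r : R) : (0 < r)%R ->
  0 < ess_inf_on mu (ball x r) w.
Proof.
move=> r0; have [y [s [s0 int_gt0]]] := exists_ball_integral_gt0.
have xy := mdist_ge0 x y.
pose t := (r + s + mdist x y)%R.
have t0 : (0 < t)%R by rewrite /t; lra.
apply: (@lt_le_trans _ _ (ess_inf_on mu (ball x t) w)); last first.
  by apply: subset_ess_inf_on; apply: subset_ball; rewrite mdistxx /t; lra.
have avg_gt0 : 0 < avg mu (ball x t) w.
  apply: avg_ball_gt0 => //; apply: lt_le_trans int_gt0 _.
  apply: ge0_subset_integral => //; first exact: measurable_int (w_int _ _ _).
  by apply: subset_ball; rewrite /t; lra.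
(* A zero essential infimum would make the right side of the A_1 inequality 0, below the positive
   average. *)
have := lt_le_trans avg_gt0 (wC _ (balls_ball x t t0)).
have := ess_inf_on_ge0 mu (ball x t) w w_ge0.
by rewrite le_eqVlt => /predU1P[<-|//]; rewrite mule0 ltxx.
Qed.

Lemma A1_bound_gt0 : (0 < C)%R.
Proof.
have [y [s [s0 int_gt0]]] := exists_ball_integral_gt0.
have := lt_le_trans (avg_ball_gt0 _ _ s0 int_gt0)
  (wC _ (balls_ball y s s0)).
by rewrite pmule_lgt0 ?lte_fin // A1_bound_ess_inf_gt0.
Qed.

Lemma A1_bound_L1loc_log : L1loc mu log_w.
Proof.
move=> K cK; have [r r0 Kr] := compact_sub_ball K point cK.
have mK : measurable (K : set (borel X)).
  apply: measurable_closed; apply: compact_closed cK.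
  exact: metric_hausdorff.
have [a a0 aw] := ess_inf_on_gt0 _ _ _ (A1_bound_ess_inf_gt0 point r r0).
apply: (integrableS (mball point r) mK Kr).
exact: (integrable_lne mu _ (mball _ _) (ball_lty _ _ r0) w a a0
  (w_int _ _ r0) w_ge0 aw).
Qed.

(** The three quantities are finite, which turns the estimates into real arithmetic: [L] is not -oo
    since [w] has positive essential infimum, and not +oo since it is at most [l]. *)
Lemma A1_bound_ball B : balls B ->
  exists a l L : R, [/\ avg mu B w = a%:E, avg mu B log_w = l%:E &
    ess_inf_on mu B log_w = L%:E] /\
    [/\ (expR l <= a)%R, (L <= l)%R & (a <= C * expR L)%R].
Proof.
move=> bB; have := wC _ bB; case: bB => x [r [r0 ->]].
have := A1_bound_ess_inf_gt0 x r r0.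
rewrite -(expeR_ess_inf_on_lne mu (ball x r) w w_ge0).
have li : mu.-integrable (ball x r) log_w.
  exact: L1loc_integrable_ball A1_bound_L1loc_log.
have mB := mball x r; have B0 := ball_gt0 x r r0; have Boo := ball_lty x r r0.
have afin := avg_fin_num mu _ mB B0 Boo _ (w_int x r r0).
have lfin := avg_fin_num mu _ mB B0 Boo _ li.
have := expeR_avg_lne mu _ mB B0 Boo w w_ge0 (w_int x r r0) li.
have := ess_inf_on_le_avg mu _ mB B0 Boo _ li.
rewrite -/log_w -(fineK afin) -(fineK lfin).
move: (fine _) (fine _) => a l.
case: (ess_inf_on _ _ _) => [L| |] //=; last by rewrite ltxx.
rewrite -EFinM !lee_fin => Ll la _ aL.
by exists a, l, L.
Qed.

Lemma A1_bound_BLO_norm : expeR (BLO_norm mu log_w) <= C%:E.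
Proof.
rewrite /BLO_norm asboolT; last exact: A1_bound_L1loc_log.
have C0 := A1_bound_gt0.
rewrite -(lnK C0) -[leRHS]/(expeR (ln C)%:E) lee_expeR.
apply: ge_ereal_sup => _ [B bB <-].
have [a [l [L [[_ -> ->] [la _ aL]]]]] := A1_bound_ball B bB.
rewrite -EFinB lee_fin -ler_expR lnK // expRD expRN ler_pdivrMr ?expR_gt0 //.
exact: le_trans la aL.
Qed.

Lemma A1_bound_Ainfty_const : Ainfty_const mu w <= C%:E.
Proof.
have C0 := A1_bound_gt0.
apply: ge_ereal_sup => _ [B bB <-].
have [a [l [L [[-> -> _] [_ Ll aL]]]]] := A1_bound_ball B bB.
rewrite /= -EFinM lee_fin expRN ler_pdivrMr ?expR_gt0 //.
by apply: le_trans aL _; rewrite ler_pM2l // ler_expR.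
Qed.

End A1.

Lemma A1_bound_Ainfty_BLO (A N : R) : L1loc mu log_w ->
  Ainfty_const mu w = A%:E -> BLO_norm mu log_w = N%:E ->
  A1_bound mu w (A * expR N).
Proof.
move=> log_loc Ainf; rewrite /BLO_norm asboolT // => BLOn B bB.
have : avg mu B w * expeR (- avg mu B log_w) <= A%:E.
  by rewrite -Ainf; apply: ereal_sup_ubound; exists B.
have : avg mu B log_w - ess_inf_on mu B log_w <= N%:E.
  by rewrite -BLOn; apply: ereal_sup_ubound; exists B.
rewrite -(expeR_ess_inf_on_lne mu B w w_ge0) -/log_w.
have := avg_ge0 B; case: bB => x [r [r0 ->]].
have li := L1loc_integrable_ball mu mu_doubling _ x r r0 log_loc.
have mB := mball x r; have B0 := ball_gt0 x r r0; have Boo := ball_lty x r r0.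
have afin := avg_fin_num mu _ mB B0 Boo _ (w_int x r r0).
have lfin := avg_fin_num mu _ mB B0 Boo _ li.
have := ess_inf_on_le_avg mu _ mB B0 Boo _ li.
rewrite -(fineK afin) -(fineK lfin); move: (fine _) (fine _) => a l.
(* The value -oo would make the oscillation +oo, above [N]; +oo would exceed the average [l]. *)
case: (ess_inf_on _ _ _) => [L| |] //=.
rewrite -EFinB -!EFinM !lee_fin expRN ler_pdivrMr ?expR_gt0 // => _ a0 lL al.
apply: (le_trans al); rewrite -mulrA -expRD ler_wpM2l //; last first.
  by rewrite ler_expR; lra.
by have := le_trans a0 al; rewrite pmulr_lge0 // expR_gt0.
Qed.

(** Even if log w is not integrable, its average is below +oo, so the exponential factor is
    positive. The final product then never has the form 0 times +oo. *)
Lemma Ainfty_const_gt0 : 0 < Ainfty_const mu w.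
Proof.
have [x [r [r0 int_gt0]]] := exists_ball_integral_gt0.
apply: (@lt_le_trans _ _ (avg mu (ball x r) w *
    expeR (- avg mu (ball x r) log_w))); last first.
  by apply: ereal_sup_ubound; exists (ball x r) => //; exists x, r.
rewrite mule_gt0 ?avg_ball_gt0 // expeR_gt0 // lteNr /=.
apply: (avg_lty mu _ (mball x r) (ball_gt0 x r r0) (ball_lty x r r0) w).
- exact: w_int.
- exact: measurable_lne_comp (mball x r) (measurable_int _ (w_int x r r0)).
- exact: w_ge0.
- by move=> y; exact: lne_le_id.
Qed.

End weights.

Theorem theorem5p1 (R : realType) (X : completeMetricType R)
  (mu : {measure set (borel X) -> \bar R}) (w : X -> \bar R)
  (mu_doubling : doubling mu) (w_weight : weight mu w)
  (w_neq0 : ~ (\forall x \ae mu, w x = 0)) :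
  let log_w := fun x => lne (w x) in
  (A1 mu w <-> Ainfty mu w /\ BLO mu log_w) /\
  (expeR (BLO_norm mu log_w) <= A1_const mu w /\
   A1_const mu w <= Ainfty_const mu w * expeR (BLO_norm mu log_w)).
Proof.
move=> log_w.
have Ainf_gt0 := Ainfty_const_gt0 mu mu_doubling w w_weight w_neq0.
have BLO_ge0 := BLO_norm_ge0 mu mu_doubling log_w.
have fin_bound := A1_bound_Ainfty_BLO mu mu_doubling w w_weight.
rewrite -/log_w in fin_bound.
split; [split|split].
- move=> [_ [C wC]].
  have Ainf_le := A1_bound_Ainfty_const mu mu_doubling w w_weight w_neq0 C wC.
  have BLO_le := A1_bound_BLO_norm mu mu_doubling w w_weight w_neq0 C wC.
  split; first by split => //; exact: le_lt_trans Ainf_le (ltry _).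
  split; first exact: A1_bound_L1loc_log wC.
  by rewrite -lte_expeR; exact: le_lt_trans BLO_le (ltry _).
- move=> [[_ Ainf_lty] [log_loc BLO_lty]]; split => //.
  exists (fine (Ainfty_const mu w) * expR (fine (BLO_norm mu log_w)))%R.
  by apply: fin_bound => //; rewrite fineK // ge0_fin_numE // ltW.
(* The bound holds for every admissible [C]; if there is none, the infimum is +oo. *)
- apply: le_ereal_inf_tmp => _ [C wC <-].
  exact: A1_bound_BLO_norm wC.
- have [->|BLO_lty] := eqVneq (BLO_norm mu log_w) +oo.
    by rewrite /= gt0_muley // leey.
  have [->|Ainf_lty] := eqVneq (Ainfty_const mu w) +oo.
    by rewrite gt0_mulye ?leey // expeR_gt0 // (lt_le_trans _ BLO_ge0).
  (* A norm other than +oo forces local integrability, by the convention in [BLO_norm]. *)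
  have log_loc : L1loc mu log_w.
    by apply: contrapT => nloc; move: BLO_lty; rewrite /BLO_norm asboolF ?eqxx.
  have AE : Ainfty_const mu w = (fine (Ainfty_const mu w))%:E.
    by rewrite fineK // ge0_fin_numE ?ltey // ltW.
  have NE : BLO_norm mu log_w = (fine (BLO_norm mu log_w))%:E.
    by rewrite fineK // ge0_fin_numE ?ltey.
  have wC := fin_bound _ _ log_loc AE NE.
  rewrite AE NE /= -EFinM; apply: ereal_inf_lbound.
  by exists (fine (Ainfty_const mu w) * expR (fine (BLO_norm mu log_w)))%R.
Qed.
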